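(* Let $\mathfrak g$ be a unimodular $4n$-dimensional almost-abelian Lie algebra endowed with a hypercomplex structure $(I,J,K)$ and a hyperhermitian metric $g$. Then $(I,J,K,g)$ is HKT if and only if $(I,J,K,g)$ is hyperkähler.
   Context: A real Lie algebra is almost-abelian if it has a codimension-one abelian ideal. A hypercomplex structure on $\mathfrak g$ is a triple of integrable complex structures $I,J,K$ on $\mathfrak g$ (vanishing Nijenhuis tensors) that pairwise anticommute with $IJ=K$; a hyperhermitian metric is an inner product $g$ on $\mathfrak g$ that is Hermitian for $I,J,K$. Forms are elements of $\Lambda^\bullet\mathfrak g^*\otimes\mathbb C$ with the Chevalley–Eilenberg differential $d$; $\partial$ is the $(1,0)$-part of $d$ with respect to $I$. Put $\omega_L(x,y)=g(Lx,y)$ for $L=I,J,K$ and $\Omega=\tfrac12(\omega_J+\sqrt{-1}\,\omega_K)$, a $(2,0)$-form for $I$. $(I,J,K,g)$ is HKT if $\partial\Omega=0$, and hyperkähler if $d\Omega=0$ (equivalently $d\omega_I=d\omega_J=d\omega_K=0$). *)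

(* Defs.v *)
From HB Require Import structures.
From mathcomp Require Import all_boot all_order all_algebra.
From mathcomp Require Import sesquilinear complex.
From mathcomp Require Import reals.

Set Implicit Arguments.
Unset Strict Implicit.
Unset Printing Implicit Defensive.

Import Order.TTheory GRing.Theory Num.Theory.

Local Open Scope ring_scope.
Local Open Scope complex_scope.

Section LieAlgebra.
Variables (R : realType) (V : vectType R).
Implicit Types (br : {bilinear V -> V -> V}) (U : {vspace V}).

Definition is_lie_bracket br : Prop :=
  (forall x, br x x = 0) /\
  (forall x y z, br x (br y z) + br y (br z x) + br z (br x y) = 0).

Definition endo_trace (f : V -> V) : R :=
  let b := vbasis {:V} in \sum_(i < \dim {:V}) coord b i (f b`_i).

Definition unimodular br : Prop := forall x, endo_trace (br x) = 0.

Definition is_ideal br U : Prop := forall x u, u \in U -> br x u \in U.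

Definition is_abelian br U : Prop :=
  forall u v, u \in U -> v \in U -> br u v = 0.

Definition almost_abelian br : Prop :=
  exists U, [/\ (\dim U).+1 = \dim {:V}, is_ideal br U & is_abelian br U].

End LieAlgebra.

Section Structures.
Variables (R : realType) (V : vectType R).
Implicit Types (br : {bilinear V -> V -> V}) (I J K L : 'End(V)).
Implicit Types (g : {biscalar V}).

Definition nijenhuis br L (x y : V) : V :=
  br (L x) (L y) - L (br (L x) y) - L (br x (L y)) - br x y.

Definition is_complex_structure br L : Prop :=
  (forall x, L (L x) = - x) /\ (forall x y, nijenhuis br L x y = 0).

Definition anticommute L M : Prop := forall x : V, L (M x) = - M (L x).

Record is_hypercomplex br I J K : Prop := IsHypercomplex {
  hypercomplexI : is_complex_structure br I;
  hypercomplexJ : is_complex_structure br J;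
  hypercomplexK : is_complex_structure br K;
  hypercomplex_antiIJ : anticommute I J;
  hypercomplex_antiJK : anticommute J K;
  hypercomplex_antiIK : anticommute I K;
  hypercomplex_IJ : forall x, I (J x) = K x }.

Definition is_inner_product g : Prop :=
  (forall x y, g x y = g y x) /\ (forall x, x != 0 -> 0 < g x x).

Definition hermitian_wrt g L : Prop := forall x y, g (L x) (L y) = g x y.

Definition is_hyperhermitian I J K g : Prop :=
  [/\ is_inner_product g, hermitian_wrt g I, hermitian_wrt g J
    & hermitian_wrt g K].

End Structures.

Section Forms.
Variables (R : realType) (V : vectType R).
Implicit Types (br : {bilinear V -> V -> V}) (I J K L : 'End(V)).
Implicit Types (g : {biscalar V}) (k p : nat).

(* The elements of Lambda^k V^* (x) C are the R-multilinear alternating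
   functions among the following; the operators below are given by formulas
   which make sense for all functions and preserve those. *)
Definition cochain k := ('I_k -> V) -> R[i].

(* (d a)(x_0, .., x_k) is the sum over i < j of
   (-1)^(i+j) a([x_i, x_j], x_0, .., x_k) with x_i and x_j omitted;
   for i < j, [bump j (bump i l)] is the l-th natural number outside {i, j}. *)
Definition ce_args br k (x : 'I_k.+1 -> V) (i j : 'I_k.+1) : 'I_k -> V :=
  fun m => if m == 0%N :> nat then br (x i) (x j)
           else x (inord (bump j (bump i m.-1))).

Definition ce_diff br k (a : cochain k) : cochain k.+1 :=
  fun x => \sum_(i < k.+1) \sum_(j < k.+1 | (i < j)%N)
             (-1) ^+ (i + j) * a (ce_args br x i j).

(* A pair (u, v) stands for the vector u + sqrt(-1) v of V (x) C, and
   [form_ext a] is the C-multilinear extension of a. *)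
Definition form_ext k (a : cochain k) (z : 'I_k -> V * V) : R[i] :=
  \sum_(T : {set 'I_k})
     'i ^+ #|T| * a (fun j => if j \in T then (z j).2 else (z j).1).

(* The components (x -+ sqrt(-1) L x) / 2 of x in the +-sqrt(-1)-eigenspaces
   of L on V (x) C. *)
Definition part10 L (x : V) : V * V := (2^-1 *: x, - (2^-1 *: L x)).
Definition part01 L (x : V) : V * V := (2^-1 *: x, 2^-1 *: L x).

(* The component of type (p, k - p) with respect to L. *)
Definition form_type L p k (a : cochain k) : cochain k :=
  fun x => \sum_(S : {set 'I_k} | #|S| == p)
             form_ext a (fun j => if j \in S then part10 L (x j)
                                  else part01 L (x j)).

(* The part of d of bidegree (1, 0): on forms of type (p, q) it is the
   component of type (p + 1, q) of d. *)
Definition del br L k (a : cochain k) : cochain k.+1 :=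
  fun x => \sum_(p < k.+1) form_type L p.+1 (ce_diff br (form_type L p a)) x.

Definition fundamental_form g L (x y : V) : R := g (L x) y.

Definition Omega J K g : cochain 2 :=
  fun x => 2^-1 * ((fundamental_form g J (x 0) (x 1))%:C
                   + 'i * (fundamental_form g K (x 0) (x 1))%:C).

Definition is_HKT br I J K g : Prop :=
  forall x, del br I (Omega J K g) x = 0.

Definition is_hyperkahler br J K g : Prop :=
  forall x, ce_diff br (Omega J K g) x = 0.

End Forms.

(* Main.v *)
(* Let e be a unit normal to the abelian ideal U and D = ad e. Then
   [x, y] = g(x, e) D y - g(y, e) D x, and integrability of L says that D
   commutes with L on the part of U which L maps into U. Evaluated on the
   (1,0)-parts of e, u, v with u, v, I u, I v in U, the HKT equation becomes
   g(J D u, v) + g(J u, D v) = 0. Taking u = J e gives D J e = mu J e, hence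
   D L e = mu L e for L = I, J, K, while on the quaternionic complement of e it
   says that D is skew. Therefore tr D = 3 mu, unimodularity forces mu = 0, and
   D is skew and commutes with I, J, K everywhere, so d Omega = 0. The converse
   holds because Omega is of type (2,0), so that del Omega is the (3,0)-part
   of d Omega. *)

Require Import Defs.
From HB Require Import structures.
From mathcomp Require Import all_boot all_order all_algebra.
From mathcomp Require Import sesquilinear complex.
From mathcomp Require Import boolp reals ring lra.

Set Implicit Arguments.
Unset Strict Implicit.
Unset Printing Implicit Defensive.

Import Order.TTheory GRing.Theory Num.Theory.

Local Open Scope ring_scope.

(** * Traces of rank-one maps and of skew maps *)

Section Trace.
Variables (R : realType) (V : vectType R).
Implicit Types f h : V -> V.

Lemma endo_traceD f h : endo_trace (fun x => f x + h x) = endo_trace f + endo_trace h.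
Proof. by rewrite /endo_trace -big_split; apply: eq_bigr => i _; rewrite linearD. Qed.

Variable g : {biscalar V}.

Lemma endo_trace_rank1 u v : endo_trace (fun x => g x u *: v) = g v u.
Proof.
rewrite [in RHS](coord_vbasis (memvf v)) linear_sumlz; apply: eq_bigr => i _.
by rewrite linearZl_LR linearZ /= mulrC.
Qed.

Hypothesis g_ip : is_inner_product g.

(** In a basis with Gram matrix [G], skewness of the map with matrix [M] reads [M G = - G M^T]. As
    [G] is invertible, [M] is conjugate to [- M^T], so its trace equals its own opposite. *)
Lemma endo_trace_skew f :
  (forall x y, g (f x) y = - g x (f y)) -> endo_trace f = 0.
Proof.
move=> fskew; pose b := vbasis {:V}.
pose M := \matrix_(i < \dim {:V}, j < \dim {:V}) coord b j (f b`_i).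
pose G := \matrix_(i < \dim {:V}, j < \dim {:V}) g b`_i b`_j.
have fE (i : 'I_(\dim {:V})) : f b`_i = \sum_j M i j *: b`_j.
  rewrite {1}(coord_vbasis (memvf (f b`_i))).
  by apply: eq_bigr => j _; rewrite mxE.
have MG : M *m G = - (G *m M^T).
  apply/matrixP => i k; rewrite !mxE.
  transitivity (g (f b`_i) b`_k).
    rewrite fE linear_sumlz; apply: eq_bigr => j _.
    by rewrite linearZl_LR !mxE.
  rewrite fskew fE linear_sumr; congr (- _); apply: eq_bigr => j _.
  by rewrite linearZr_LR !mxE mulrC.
(* A row in the kernel of [G] gives a vector orthogonal to the whole basis, hence to itself;
   positivity makes it zero. *)
have Gunit : G \in unitmx.
  rewrite -row_free_unit -kermx_eq0; apply/rowV0P => v /sub_kermxP vG.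
  pose x := \sum_i v 0 i *: b`_i.
  have gx (j : 'I_(\dim {:V})) : g x b`_j = 0.
    transitivity ((v *m G) 0 j); last by rewrite vG mxE.
    rewrite linear_sumlz !mxE; apply: eq_bigr => i _.
    by rewrite linearZl_LR !mxE.
  have x0 : x = 0.
    apply/eqP/negPn/negP => /(proj2 g_ip); rewrite {2}/x linear_sumr big1 ?ltxx //.
    by move=> i _; rewrite linearZr_LR /= gx mulr0.
  apply/rowP => i; rewrite mxE.
  by rewrite -(coord_sum_free (fun i => v 0 i) i (basis_free (vbasisP {:V}))) -/x x0 linear0.
have trM : \tr M = - \tr M.
  rewrite -[in LHS](mulmxK Gunit M) MG mulNmx linearN /= mxtrace_mulC mulmxA.
  by rewrite mulVmx // mul1mx mxtrace_tr.
have -> : endo_trace f = \tr M by apply: eq_bigr => i _; rewrite mxE.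
by lra.
Qed.

End Trace.

(** * A unit normal to a hyperplane *)

Section Normal.
Variables (R : realType) (V : vectType R) (g : {biscalar V}) (U : {vspace V}).
Hypothesis g_ip : is_inner_product g.
Hypothesis codimU : (\dim U).+1 = \dim {:V}.

Definition pairing x : 'rV[R]_(\dim U) := \row_i g x (vbasis U)`_i.

Lemma pairing_linear : linear pairing.
Proof. by move=> a x y; apply/rowP => i; rewrite !mxE linearPl. Qed.

HB.instance Definition _ :=
  GRing.isLinear.Build R V 'rV[R]_(\dim U) *:%R pairing pairing_linear.

(** [pairing] takes values in a space of dimension [\dim U], one less than that of [V], so its
    kernel, the orthogonal of [U], is nonzero. *)
Lemma ex_orthogonal : exists2 v, v != 0 & forall u, u \in U -> g v u = 0.
Proof.
pose W := lker (linfun pairing).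
have W0 : W != 0%VS.
  have := limg_ker_dim (linfun pairing) fullv; rewrite capfv -codimU -/W.
  have := dimvS (subvf (linfun pairing @: fullv)%VS); rewrite dimvf /dim /= mul1n.
  rewrite -dimv_eq0; case: (\dim W) => // dim_le; rewrite add0n => dimE.
  by move: dim_le; rewrite dimE ltnn.
exists (vpick W); rewrite ?vpick0 // => u uU.
have : vpick W \in W by apply: memv_pick.
rewrite memv_ker lfunE /= => /eqP/rowP pick0.
rewrite (coord_vbasis uU) linear_sumr big1 // => i _.
by rewrite linearZr_LR /=; have := pick0 i; rewrite !mxE => ->; rewrite mulr0.
Qed.

Lemma ex_unit_normal : exists2 e, g e e = 1 & forall x, (x \in U) = (g x e == 0).
Proof.
have [v v0 vU] := ex_orthogonal; have [gsym gpos] := g_ip.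
have gv := gpos v v0; pose e := (Num.sqrt (g v v))^-1 *: v.
have ge1 : g e e = 1.
  rewrite linearZl_LR linearZr_LR /= mulrA -invfM -expr2 sqr_sqrtr ?ltW //.
  by rewrite mulVf // gt_eqF.
have eU u : u \in U -> g u e = 0.
  by move=> uU; rewrite gsym linearZl_LR /= (vU u) ?mulr0.
exists e => // x; apply/idP/eqP => [/eU //|xe].
(* The sum is direct because [e] is orthogonal to [U] and not to itself; the dimensions then add up
   to that of [V]. *)
have UeV : (U + <[e]>)%VS = fullv.
  apply/eqP; rewrite eqEdim subvf -codimU dimv_disjoint_sum.
    rewrite dim_vline; suff ->: e != 0 by rewrite /= addn1.
    by apply/eqP => e0; move: ge1; rewrite e0 linear0l => /esym/eqP; rewrite oner_eq0.
  apply/eqP; rewrite -subv0; apply/subvP => y; rewrite memv_cap memv0.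
  case/andP=> yU /vlineP[c yE]; have := eU y yU.
  by rewrite yE linearZl_LR /= ge1 mulr1 => ->; rewrite scale0r.
have : x \in (U + <[e]>)%VS by rewrite UeV memvf.
case/memv_addP => u uU [_ /vlineP[c ->] xE].
have := xe; rewrite xE linearDl linearZl_LR /= eU // add0r ge1 mulr1 => ->.
by rewrite scale0r addr0.
Qed.

End Normal.

(** * Sums over the subsets of a set with two or three elements *)

Lemma complexE_i (R : realType) (a b : R) : a%:C%C + 'i * b%:C%C = (a +i* b)%C.
Proof. by rewrite [RHS]complexE. Qed.

(** A subset is encoded by its membership bits, which turns the sums in [form_ext] into explicit
    ones. *)
Lemma big_set_ord2 (M : nmodType) (F : {set 'I_2} -> M) :
  \sum_(T : {set 'I_2}) F T =
  \sum_(b : bool) \sum_(c : bool) F [set j : 'I_2 | nth false [:: b; c] j].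
Proof.
rewrite pair_big /=.
rewrite (reindex (fun p : bool * bool => [set j : 'I_2 | nth false [:: p.1; p.2] j])) //=.
exists (fun T : {set 'I_2} => (ord0 \in T, ord_max \in T)) => [[b c] _|T _] /=.
  by rewrite !inE.
apply/setP => j; rewrite !inE; case: (unliftP ord0 j) => [k ->|-> //].
by rewrite (ord1 k) /=; congr (_ \in T); apply: val_inj.
Qed.

Lemma big_set_ord3 (M : nmodType) (F : {set 'I_3} -> M) :
  \sum_(T : {set 'I_3}) F T =
  \sum_(a : bool) \sum_(b : bool) \sum_(c : bool)
     F [set j : 'I_3 | nth false [:: a; b; c] j].
Proof.
under [RHS]eq_bigr do rewrite pair_big /=.
rewrite pair_big /=.
rewrite (reindex (fun p : bool * (bool * bool) =>
   [set j : 'I_3 | nth false [:: p.1; p.2.1; p.2.2] j])) //=.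
exists (fun T : {set 'I_3} => (ord0 \in T, (lift ord0 ord0 \in T, ord_max \in T)))
  => [[b [c d]] _|T _] /=.
  by rewrite !inE.
apply/setP => j; rewrite !inE /=; case: (unliftP ord0 j) => [k ->|-> //].
case: (unliftP ord0 k) => [l ->|-> //]; rewrite (ord1 l) /=.
by congr (_ \in T); apply: val_inj.
Qed.

Lemma card_set_nth n (s : seq bool) :
  #|[set j : 'I_n | nth false s j]| = (\sum_(j < n) nth false s j)%N.
Proof.
by rewrite -sum1_card big_mkcond /=; apply: eq_bigr => i _; rewrite inE; case: nth.
Qed.

(** * Types and complex extensions of forms in low degree *)

Section Forms.
Variables (R : realType) (V : vectType R) (br : {bilinear V -> V -> V}).

Lemma card_setT_ord k (S : {set 'I_k}) : (#|S| == k) = (S == setT).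
Proof.
by rewrite eqEcard subsetT cardsT card_ord eqn_leq -[X in (_ <= X)%N](card_ord k) max_card.
Qed.

Lemma form_type_full k L (a : cochain V k) x :
  form_type L k a x = form_ext a (fun j => part10 L (x j)).
Proof.
rewrite /form_type (big_pred1 setT) => [|S]; last exact: card_setT_ord.
by congr form_ext; apply/funext => j; rewrite in_setT.
Qed.

Lemma ce_diff_const0 k : ce_diff br (fun=> 0 : R[i]) = (fun=> 0) :> cochain V k.+1.
Proof. by apply/funext => x; rewrite /ce_diff; do 2!(rewrite big1 // => ? _); rewrite mulr0. Qed.

Lemma form_ext_const0 k z : form_ext ((fun=> 0) : cochain V k) z = 0.
Proof. by rewrite /form_ext big1 // => T _; rewrite mulr0. Qed.

Lemma form_type_const0 L p k : form_type L p (fun=> 0 : R[i]) = (fun=> 0) :> cochain V k.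
Proof. by apply/funext => x; rewrite /form_type big1 // => S _; apply: form_ext_const0. Qed.

(** Every list supplied below has length [k], so the default [0] is never reached. *)
Definition vargs k (s : seq V) : 'I_k -> V := fun j => nth 0 s j.

Lemma form_ext2 (a : cochain V 2) z : form_ext a z =
  a (vargs [:: (z 0).1; (z 1).1])
  + 'i * (a (vargs [:: (z 0).2; (z 1).1]) + a (vargs [:: (z 0).1; (z 1).2]))
  - a (vargs [:: (z 0).2; (z 1).2]).
Proof.
rewrite /form_ext big_set_ord2 !big_bool /= !card_set_nth !big_ord_recl !big_ord0 /=.
pose pick (j : 'I_2) (b : bool) := if b then (z j).2 else (z j).1.
have E b c : (fun j : 'I_2 => if j \in [set j : 'I_2 | nth false [:: b; c] j]
    then (z j).2 else (z j).1) = vargs [:: pick 0 b; pick 1 c].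
  apply/funext => j; rewrite inE.
  case: (unliftP ord0 j) => [k ->|-> //]; rewrite (ord1 k) /=.
  by have -> : lift ord0 ord0 = 1 :> 'I_2 by apply: val_inj.
by rewrite !E /pick /bump /= ?addn0 sqrCi; ring.
Qed.

Lemma form_ext3 (a : cochain V 3) z :
  let A b c d := a (vargs [:: if b then (z ord0).2 else (z ord0).1;
     if c then (z (lift ord0 ord0)).2 else (z (lift ord0 ord0)).1;
     if d then (z ord_max).2 else (z ord_max).1]) in
  form_ext a z =
  A false false false + 'i * (A true false false + A false true false + A false false true)
  - (A true true false + A true false true + A false true true) - 'i * A true true true.
Proof.
rewrite /= /form_ext big_set_ord3 !big_bool /= !card_set_nth !big_ord_recl !big_ord0 /=.
pose pick (j : 'I_3) (b : bool) := if b then (z j).2 else (z j).1.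
have E b c d : (fun j : 'I_3 => if j \in [set j : 'I_3 | nth false [:: b; c; d] j]
    then (z j).2 else (z j).1) =
    vargs [:: pick ord0 b; pick (lift ord0 ord0) c; pick ord_max d].
  apply/funext => j; rewrite inE.
  case: (unliftP ord0 j) => [k ->|-> //]; case: (unliftP ord0 k) => [l ->|-> //].
  rewrite (ord1 l) /=.
  by have -> : lift ord0 (lift ord0 ord0) = ord_max :> 'I_3 by apply: val_inj.
rewrite !E /pick /bump /= ?addn0.
rewrite (exprS _ 2) sqrCi; ring.
Qed.

End Forms.

(** * Quaternionic relations and the adjoints of [I], [J], [K] *)

Section HyperHermitian.
Variables (R : realType) (V : vectType R) (br : {bilinear V -> V -> V}).
Variables (I J K : 'End(V)) (g : {biscalar V}).
Hypotheses (hyp : is_hypercomplex br I J K) (herm : is_hyperhermitian I J K g).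

Lemma sqI x : I (I x) = - x.
Proof. by case: hyp => -[]. Qed.
Lemma sqJ x : J (J x) = - x.
Proof. by case: hyp => _ -[]. Qed.
Lemma sqK x : K (K x) = - x.
Proof. by case: hyp => _ _ -[]. Qed.
Lemma mulIJ x : I (J x) = K x.
Proof. by case: hyp. Qed.
Lemma mulIK x : I (K x) = - J x.
Proof. by rewrite -mulIJ sqI. Qed.
Lemma mulJI x : J (I x) = - K x.
Proof. by case: hyp => _ _ _ + _ _ _ => /(_ x); rewrite mulIJ => ->; rewrite opprK. Qed.
Lemma mulKI x : K (I x) = J x.
Proof. by case: hyp => _ _ _ _ _ + _ => /(_ x); rewrite mulIK => /oppr_inj. Qed.
Lemma mulJK x : J (K x) = I x.
Proof. by rewrite -mulIJ mulJI -mulIJ sqJ linearN opprK. Qed.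
Lemma mulKJ x : K (J x) = - I x.
Proof. by rewrite -mulIJ sqJ linearN. Qed.
Definition mulQ := (sqI, sqJ, sqK, mulIJ, mulIK, mulJI, mulKI, mulJK, mulKJ).

Lemma metric_sym x y : g x y = g y x.
Proof. by case: herm => -[]. Qed.

Lemma metric_gt0 x : x != 0 -> 0 < g x x.
Proof. by case: herm => -[_ +] _ _ _; apply. Qed.

Lemma metric_eq0 x : g x x = 0 -> x = 0.
Proof. by move=> gx; apply/eqP/negPn/negP => /metric_gt0; rewrite gx ltxx. Qed.

Lemma metricI x y : g (I x) y = - g x (I y).
Proof. by case: herm => _ + _ _ => /(_ x (I y)) <-; rewrite sqI linearNr opprK. Qed.
Lemma metricJ x y : g (J x) y = - g x (J y).
Proof. by case: herm => _ _ + _ => /(_ x (J y)) <-; rewrite sqJ linearNr opprK. Qed.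
Lemma metricK x y : g (K x) y = - g x (K y).
Proof. by case: herm => _ _ _ /(_ x (K y)) <-; rewrite sqK linearNr opprK. Qed.

(** * The form [Omega], its type and its differential *)

Local Notation Om := (Omega J K g).

(** Twice [Omega], as a function of two vectors. *)
Definition omegaC x y : R[i] := (g (J x) y +i* g (K x) y)%C.

Lemma OmegaE x : Om x = 2^-1 * omegaC (x 0) (x 1).
Proof. by rewrite /Omega complexE_i. Qed.

Lemma omegaCN x y : omegaC x (- y) = - omegaC x y.
Proof. by rewrite /omegaC !linearNr. Qed.

Lemma omegaCZ c x y : omegaC x (c *: y) = c%:C%C * omegaC x y.
Proof. by rewrite /omegaC !linearZr_LR /=; simpc. Qed.

Lemma omegaC_anti x y : omegaC x y = - omegaC y x.
Proof. by rewrite /omegaC metricJ metricK !(metric_sym x). Qed.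

(** Moving [I] across [g] turns [J] into [- K] and [K] into [J]. With [omegaIC], this says that
    [Omega] has type (2,0). *)
Lemma omegaCI x y : omegaC x (I y) = 'i * omegaC x y.
Proof.
rewrite /omegaC -complexE_i.
rewrite -[g (J x) _]opprK -[g (K x) _]opprK -!metricI !mulQ !linearNl opprK.
by rewrite -complexE_i !rmorphN /= mulrDr mulrA -expr2 sqrCi mulN1r addrC.
Qed.

Lemma omegaIC x y : omegaC (I x) y = 'i * omegaC x y.
Proof. by rewrite omegaC_anti omegaCI omegaC_anti mulrN opprK. Qed.

Lemma omegaNC x y : omegaC (- x) y = - omegaC x y.
Proof. by rewrite omegaC_anti omegaCN omegaC_anti opprK. Qed.

Lemma omegaZC c x y : omegaC (c *: x) y = c%:C%C * omegaC x y.
Proof. by rewrite omegaC_anti omegaCZ omegaC_anti mulrN opprK. Qed.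

(** Since [I] acts on each argument as ['i], a (0,1)-part in either slot gives zero and a (1,0)-part
    reproduces the value on the vector itself. Only the full subset [S] contributes. *)
Lemma form_type_Omega p : form_type I p Om = if p == 2%N then Om else fun=> 0.
Proof.
apply/funext => x.
have halfC : (2^-1 : R)%:C%C = 2^-1 :> R[i] by rewrite fmorphV rmorph_nat.
transitivity (\sum_(S : {set 'I_2} | #|S| == p) if S == setT then Om x else 0).
  apply: eq_bigr => S _; rewrite form_ext2 !OmegaE /vargs /=.
  rewrite -card_setT_ord -sum1_card big_mkcond !big_ord_recl big_ord0 /=.
  have -> : lift ord0 ord0 = 1 :> 'I_2 by apply: val_inj.
  case: (0 \in S); case: (1 \in S) => /=;
  rewrite !(omegaNC, omegaCN, omegaZC, omegaCZ, omegaCI, omegaIC) halfC;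
  by move: (omegaC _ _) ('i : R[i]) (sqrCi R[i]) => w i i2; field: i2.
rewrite -big_mkcondr /=; case: eqP => [->|np].
  by rewrite (big_pred1 setT) // => S; rewrite card_setT_ord andbb.
rewrite big_pred0 // => S; apply/negP => /andP[/eqP Sp].
by rewrite -card_setT_ord Sp => /eqP.
Qed.

(** Only the summand [p = 2] of [del] survives, and it is the (3,0)-part of the differential. *)
Lemma del_Omega x :
  del br I Om x = form_ext (ce_diff br Om) (fun j => part10 I (x j)).
Proof.
rewrite /del !big_ord_recl big_ord0 !form_type_Omega /= !ce_diff_const0.
by rewrite !form_type_const0 !add0r addr0 form_type_full.
Qed.

Lemma ce_diff_Omega x (u := x ord0) (v := x (lift ord0 ord0)) (w := x ord_max) :
  ce_diff br Om x =
  - 2^-1 * (omegaC (br u v) w - omegaC (br u w) v + omegaC (br v w) u).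
Proof.
have E i j : Om (ce_args br x i j) =
    2^-1 * omegaC (br (x i) (x j)) (x (inord (bump j (bump i 0)))).
  by rewrite OmegaE.
have lift2 : lift ord0 (lift ord0 ord0) = ord_max :> 'I_3 by apply: val_inj.
have [i0 i1 i2] : [/\ inord 0 = ord0 :> 'I_3, inord 1 = lift ord0 ord0 :> 'I_3
    & inord 2 = ord_max :> 'I_3].
  by split; apply: val_inj; rewrite /= inordK.
rewrite /ce_diff !big_ord_recl !big_ord0.
do 3!rewrite big_mkcond !big_ord_recl !big_ord0 /=.
rewrite !E /bump /= !lift2 !addn0 !i0 !i1 !i2 -/u -/v -/w.
by move: (omegaC _ w) (omegaC _ v) (omegaC _ u) => a b c; ring.
Qed.

(** * The bracket in terms of [D = br e], with [e] a unit normal to the abelian ideal *)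

Section UnitNormal.
Variable e : V.
Hypotheses (ge1 : g e e = 1) (bree : br e e = 0).
Hypothesis brE : forall x y, br x y = g x e *: br e y - g y e *: br e x.
Hypothesis bre_orth : forall x, g (br e x) e = 0.

Lemma orthI : g (I e) e = 0.
Proof. by have := metricI e e; rewrite (metric_sym e); lra. Qed.
Lemma orthJ : g (J e) e = 0.
Proof. by have := metricJ e e; rewrite (metric_sym e); lra. Qed.
Lemma orthK : g (K e) e = 0.
Proof. by have := metricK e e; rewrite (metric_sym e); lra. Qed.

(** As [L e], [u] and [L u] are orthogonal to [e], their mutual brackets vanish, and the Nijenhuis
    equation at [e], [u] reduces to [L (D (L u)) = - D u]. *)
Lemma bre_comm L u : is_complex_structure br L -> g (L e) e = 0 ->
  g u e = 0 -> g (L u) e = 0 -> br e (L u) = L (br e u).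
Proof.
case=> sqL nijL Le ue Lue; have /eqP := nijL e u.
rewrite /nijenhuis (brE (L e)) (brE (L e) u) Le ue Lue !scale0r subr0 linear0 !subr0.
by rewrite sub0r subr_eq0 => /eqP <-; rewrite linearN /= sqL opprK.
Qed.

Lemma HKT_omegaC u v : is_HKT br I J K g ->
    g u e = 0 -> g (I u) e = 0 -> g v e = 0 -> g (I v) e = 0 ->
  omegaC (br e u) v + omegaC u (br e v) = 0.
Proof.
move=> hkt ue Iue ve Ive.
have CI := hypercomplexI hyp.
have Du := bre_comm CI orthI ue Iue; have Dv := bre_comm CI orthI ve Ive.
(* The factors 2 cancel the 1/2 in [part10]. *)
have := hkt (vargs [:: 2 *: e; 2 *: u; 2 *: v]).
rewrite del_Omega form_ext3 /part10 /vargs /=.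
have half x : 2^-1 *: (2 *: x) = x :> V by rewrite scalerA mulVf ?pnatr_eq0 ?scale1r.
have halfI x : 2^-1 *: I (2 *: x) = I x by rewrite linearZ /= half.
rewrite !half !halfI !ce_diff_Omega /vargs /=.
(* Only brackets with [e] itself survive. As [D] commutes with [I] on [u] and [v], they are again of
   type (1,0), where [omegaC] just doubles. *)
rewrite !(linearNl, linearNr) /= !(brE (I e)) !(brE (I u)) !(brE u).
rewrite orthI ue ve Iue Ive !(scale0r, subr0, oppr0) Du Dv.
have omegaC0 x : omegaC 0 x = 0 by rewrite /omegaC !linear0 !linear0l.
rewrite !(add0r, oppr0, omegaC0, omegaNC, omegaCN, omegaCI, omegaIC).
rewrite (omegaC_anti (br e v)) => E.
have {E} : - 2 * (omegaC (br e u) v + omegaC u (br e v)) = 0.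
  by rewrite -E; move: ('i : R[i]) (sqrCi R[i]) => i i2; field: i2.
by move/eqP; rewrite mulf_eq0 oppr_eq0 pnatr_eq0 /= => /eqP.
Qed.

Lemma HKT_metricJ u v : is_HKT br I J K g ->
    g u e = 0 -> g (I u) e = 0 -> g v e = 0 -> g (I v) e = 0 ->
  g (J (br e u)) v + g (J u) (br e v) = 0.
Proof.
by move=> hkt ue Iue ve Ive; have /(congr1 (@complex.Re R)) := HKT_omegaC hkt ue Iue ve Ive.
Qed.

(** The hypotheses make [omegaC (D y) z] symmetric in [y] and [z], so the six terms of the
    differential cancel in pairs. *)
Lemma bre_skew_hyperkahler :
    (forall x, br e (J x) = J (br e x)) -> (forall x, br e (K x) = K (br e x)) ->
    (forall x y, g (br e x) y = - g x (br e y)) ->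
  is_hyperkahler br J K g.
Proof.
move=> DJ DK Dskew x.
have omegaD y z : omegaC (br e y) z = - omegaC y (br e z).
  by rewrite /omegaC -DJ -DK !Dskew.
have omegaDl y z : omegaC (br e z) y = omegaC (br e y) z.
  by rewrite omegaD omegaC_anti opprK.
have omegaB y z t : omegaC (y - z) t = omegaC y t - omegaC z t.
  by rewrite /omegaC !linearB !linearBl.
rewrite ce_diff_Omega.
move: (x ord0) (x (lift ord0 ord0)) (x ord_max) => {x} x y z.
rewrite (brE x y) (brE x z) (brE y z) !omegaB !omegaZC.
by rewrite (omegaDl x z) (omegaDl x y) (omegaDl y z); ring.
Qed.

(** * Consequences of the HKT equation: the action of [D] on [I e], [J e], [K e] *)

Section HKT.
Hypothesis hkt : is_HKT br I J K g.

Let mu := g (br e (J e)) (J e).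

Lemma metricIJ0 : g (I e) (J e) = 0.
Proof. by rewrite metricI mulIJ metric_sym orthK oppr0. Qed.
Lemma metricIK0 : g (I e) (K e) = 0.
Proof. by rewrite metricI mulIK linearNr metric_sym orthJ !oppr0. Qed.
Lemma metricJK0 : g (J e) (K e) = 0.
Proof. by rewrite metricJ mulJK metric_sym orthI oppr0. Qed.
Lemma metricJJ1 : g (J e) (J e) = 1.
Proof. by rewrite metricJ sqJ linearNr opprK. Qed.

Lemma HKT_breJ : br e (J e) = mu *: J e.
Proof.
(* The difference [y] is shown orthogonal to itself. The choice of [mu] makes it orthogonal to
   [J e]. *)
apply/eqP; rewrite -subr_eq0; apply/eqP/metric_eq0.
set y := _ - _.
have yJ : g y (J e) = 0.
  by rewrite /y linearBl linearZl_LR /= metricJJ1 mulr1 subrr.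
have yK : g y (K e) = 0.
  rewrite /y linearBl linearZl_LR /= metricJK0 mulr0 subr0.
  (* [D (K (J e)) = K (D (J e))] is orthogonal to [e], so [D (J e)] is orthogonal to [K e]. *)
  have := bre_orth (K (J e)).
  rewrite (bre_comm (hypercomplexK hyp) orthK orthJ) ?mulQ ?linearNl ?orthI ?oppr0 //.
  by rewrite metricK => /eqP; rewrite oppr_eq0 => /eqP.
have dy : g (br e (J e)) y = 0.
  (* The HKT equation at [u = J e], [v = J y], admissible because [y] is orthogonal to [J e] and
     [K e]. Its second term is [- g e (D (J y))], zero since [D] takes values orthogonal to [e]. *)
  have := HKT_metricJ (v := J y) hkt orthJ; rewrite !mulQ orthK linearNl => /(_ erefl).
  rewrite !(metricJ _ (J y)) (metricJ y) (metricK y) sqJ yJ yK !oppr0 => /(_ erefl erefl).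
  by rewrite (metric_sym e) bre_orth linearNr oppr0 addr0 opprK.
by rewrite {1}/y linearBl linearZl_LR /= dy (metric_sym (J e)) yJ mulr0 subrr.
Qed.

Lemma HKT_breK : br e (K e) = mu *: K e.
Proof.
rewrite -mulIJ (bre_comm (hypercomplexI hyp) orthI orthJ) ?mulIJ ?orthK //.
by rewrite HKT_breJ linearZ /= mulIJ.
Qed.

Lemma HKT_breI : br e (I e) = mu *: I e.
Proof.
have := bre_comm (hypercomplexK hyp) orthK orthJ.
rewrite mulKJ linearNl orthI oppr0 HKT_breJ => /(_ erefl).
by rewrite linearZ /= mulKJ scalerN linearNr => /oppr_inj.
Qed.

(** * Orthogonal projection to the quaternionic complement of [e], and skewness of [D] there *)

Let qproj x := x - (g x e *: e + g x (I e) *: I e + g x (J e) *: J e + g x (K e) *: K e).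

(** Orthogonality to [e], [I e], [J e], [K e], with the structures moved onto [x] to match the
    hypotheses of [bre_comm]. *)
Let qorth x := [/\ g x e = 0, g (I x) e = 0, g (J x) e = 0 & g (K x) e = 0].

Lemma qproj_orth x : qorth (qproj x).
Proof.
have [gI gJ gK] : [/\ g (I e) (I e) = 1, g (J e) (J e) = 1 & g (K e) (K e) = 1].
  by rewrite metricI metricJ metricK !mulQ !linearNr opprK.
rewrite /qorth !(metricI (qproj _)) !(metricJ (qproj _)) !(metricK (qproj _)).
rewrite /qproj !linearBl !linearDl !linearZl_LR /= ge1 orthI orthJ orthK gI gJ gK.
rewrite metricIJ0 metricIK0 metricJK0.
rewrite (metric_sym e (I e)) (metric_sym e (J e)) (metric_sym e (K e)) orthI orthJ orthK.
rewrite (metric_sym (J e) (I e)) (metric_sym (K e) (I e)) (metric_sym (K e) (J e)).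
rewrite metricIJ0 metricIK0 metricJK0.
by split; ring.
Qed.

Let q x := g x (I e) *: I e + g x (J e) *: J e + g x (K e) *: K e.

Lemma HKT_bre_qproj x : br e (qproj x) = br e x - mu *: q x.
Proof.
rewrite /qproj linearBr !linearDr /= !linearZr_LR /= bree scaler0 add0r.
rewrite HKT_breI HKT_breJ HKT_breK !scalerDr !scalerA.
by rewrite !(mulrC mu).
Qed.

(** The HKT equation at [u = J x], [v = y], where [J (D (J x)) = - D x]. *)
Lemma HKT_skew_qorth x y : qorth x -> qorth y -> g (br e x) y = - g x (br e y).
Proof.
move=> [xe xI xJ xK] [ye yI _ _].
have := HKT_metricJ (u := J x) (v := y) hkt xJ; rewrite mulIJ => /(_ xK ye yI).
rewrite (bre_comm (hypercomplexJ hyp) orthJ xe xJ) !mulQ !linearNl.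
by move=> h; lra.
Qed.

Lemma bre_qproj_orth x : qorth x -> qorth (br e x).
Proof.
move=> [xe xI xJ xK]; have [CI CJ CK _ _ _ _] := hyp.
by split; rewrite -?(bre_comm CI orthI xe xI) -?(bre_comm CJ orthJ xe xJ)
  -?(bre_comm CK orthK xe xK) bre_orth.
Qed.

Lemma qorth_qproj x y : qorth x -> g x (qproj y) = g x y.
Proof.
move=> [xe xI xJ xK]; rewrite /qproj linearBr !linearDr /= !linearZr_LR /= xe.
have [-> -> ->] : [/\ g x (I e) = 0, g x (J e) = 0 & g x (K e) = 0].
  by move: xI xJ xK; rewrite metricI metricJ metricK; split; lra.
by rewrite !mulr0 !addr0 subr0.
Qed.

(** [D] preserves the complement, so the other argument may be projected too; this extends skewness
    to all of [V], as the trace argument requires. *)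
Lemma bre_qproj_skew x y : g (br e (qproj x)) y = - g x (br e (qproj y)).
Proof.
have orthD z : qorth (br e (qproj z)) by apply/bre_qproj_orth/qproj_orth.
rewrite -(qorth_qproj _ (orthD x)) HKT_skew_qorth; try exact: qproj_orth.
by rewrite metric_sym (qorth_qproj _ (orthD y)) metric_sym.
Qed.

(** * Unimodularity: vanishing of [mu], and [D] on the whole space *)

Hypothesis trace0 : endo_trace (br e) = 0.

(** [D] is the sum of the skew map [D \o qproj], of trace zero, and of [mu] times the projection
    onto the span of [I e], [J e], [K e], of trace [3 * mu]. *)
Lemma HKT_mu0 : mu = 0.
Proof.
have E : br e = (fun x => br e (qproj x) + (g x (I e) *: (mu *: I e)
    + (g x (J e) *: (mu *: J e) + g x (K e) *: (mu *: K e)))) :> (V -> V).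
  apply/funext => x; rewrite -[LHS](subrK (mu *: q x)) -HKT_bre_qproj.
  by rewrite /q !scalerDr !scalerA !(mulrC mu) -!addrA.
have : endo_trace (br e) = 3 * mu.
  have [ip _ _ _] := herm.
  rewrite [in LHS]E !endo_traceD !endo_trace_rank1 (endo_trace_skew ip bre_qproj_skew).
  rewrite !linearZl_LR /= metricJJ1 metricI metricK sqI sqK !linearNr ge1.
  by ring.
by rewrite trace0; lra.
Qed.

Lemma HKT_bre : br e =1 br e \o qproj.
Proof. by move=> x; rewrite /= HKT_bre_qproj HKT_mu0 scale0r subr0. Qed.

Lemma HKT_bre_skew x y : g (br e x) y = - g x (br e y).
Proof. by rewrite [br e x]HKT_bre [br e y]HKT_bre bre_qproj_skew. Qed.

(** On the complement this is integrability of [J]; on the span of [e], [I e], [J e], [K e], which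
    [J] preserves, [D] is now zero. *)
Lemma HKT_breJ_comm x : br e (J x) = J (br e x).
Proof.
have [xe _ xJ _] := qproj_orth x.
rewrite [br e x]HKT_bre -(bre_comm (hypercomplexJ hyp) orthJ xe xJ).
rewrite /qproj !(linearB, linearD, linearZ) /= !mulQ !linearNr HKT_breI HKT_breK HKT_breJ.
by rewrite HKT_mu0 !scale0r bree !(oppr0, scaler0, addr0, subr0).
Qed.

Lemma HKT_breK_comm x : br e (K x) = K (br e x).
Proof.
have [xe _ _ xK] := qproj_orth x.
rewrite [br e x]HKT_bre -(bre_comm (hypercomplexK hyp) orthK xe xK).
rewrite /qproj !(linearB, linearD, linearZ) /= !mulQ !linearNr HKT_breI HKT_breK HKT_breJ.
by rewrite HKT_mu0 !scale0r bree !(oppr0, scaler0, addr0, subr0).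
Qed.

End HKT.
End UnitNormal.
End HyperHermitian.

(** * The equivalence of HKT and hyperkähler *)

Theorem corollary25 (R : realType) (n : nat) (V : vectType R)
    (br : {bilinear V -> V -> V}) (I J K : 'End(V)) (g : {biscalar V}) :
  \dim {:V} = (4 * n)%N ->
  is_lie_bracket br ->
  unimodular br ->
  almost_abelian br ->
  is_hypercomplex br I J K ->
  is_hyperhermitian I J K g ->
  (is_HKT br I J K g <-> is_hyperkahler br J K g).
Proof.
move=> _ [brxx _] unim [U [codimU idealU abelU]] hyp herm; split => [hkt|hk x]; last first.
  rewrite (del_Omega hyp herm) (_ : ce_diff br _ = fun=> 0) ?form_ext_const0 //.
  exact/funext.
have [ip _ _ _] := herm; have [e ge1 inU] := ex_unit_normal ip codimU.
have brC x y : br x y = - br y x.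
  by have := brxx (x + y); rewrite linearDl !linearD /= !brxx add0r addr0
    => /eqP; rewrite addr_eq0 => /eqP.
have projU x : x - g x e *: e \in U.
  by rewrite inU linearBl linearZl_LR /= ge1 mulr1 subrr.
(* Expand the vanishing bracket of the components of [x] and [y] in the abelian ideal [U]. *)
have brE x y : br x y = g x e *: br e y - g y e *: br e x.
  have := abelU _ _ (projU x) (projU y).
  rewrite linearBl !linearBr /= !linearZl_LR !linearZr_LR /= brxx !scaler0 subr0.
  by rewrite (brC x e) scalerN opprK => /eqP; rewrite subr_eq0 => /eqP <-; rewrite addrK.
(* [D] kills the [e]-component of [x] and maps the rest into the ideal [U]. *)
have bre_orth x : g (br e x) e = 0.
  apply/eqP; rewrite -inU -(subrK (g x e *: e) x) linearDr linearZr_LR /= brxx.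
  by rewrite scaler0 addr0 idealU.
apply: (bre_skew_hyperkahler hyp herm brE) => [x|x|x y].
- exact: (HKT_breJ_comm hyp herm ge1 (brxx e) brE bre_orth hkt (unim e)).
- exact: (HKT_breK_comm hyp herm ge1 (brxx e) brE bre_orth hkt (unim e)).
- exact: (HKT_bre_skew hyp herm ge1 (brxx e) brE bre_orth hkt (unim e)).
Qed.
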